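(* Let $M$ be a real representable (loopless) matroid. Then $M$ is strictly uniformly dense if and only if $M$ has a projection representation (a real symmetric matrix $T$ with $T^2=T$ whose nonsingular $\operatorname{rank}(M)\times\operatorname{rank}(M)$ principal submatrices $T_{BB}$ are exactly those indexed by bases $B$) whose diagonal entries are all equal to $\rho(M)^{-1}$.
   Context: A matroid $M$ on ground set $E$ ($|E|=n$) of rank $k$ is real representable if some real full-rank $k\times n$ matrix $X$ satisfies: a $k$-subset $B$ is a basis iff $\det(X_B)\neq 0$. Loopless: every element is in some basis. Density $\rho(M)=|E|/\operatorname{rank}(E)$. The base polytope $P(M)$ is the convex hull of indicator vectors of bases. $M$ is strictly uniformly dense if the point $(\rho(M)^{-1},\dots,\rho(M)^{-1})$ lies in the relative interior of $P(M)$; equivalently, there is a measure $\mu$ on the bases with $\mu(B)>0$ for every basis $B$ such that $\mu(\{B: B\ni e\})$ is the same for all $e\in E$. *)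

(* Defs.v *)
From HB Require Import structures.
From mathcomp Require Import all_boot all_order all_algebra.
From mathcomp Require Import reals.
Set Implicit Arguments.
Unset Strict Implicit.
Unset Printing Implicit Defensive.
Import Order.TTheory GRing.Theory Num.Theory.
Local Open Scope ring_scope.

Definition is_matroid (n : nat) (bases : {set {set 'I_n}}) : Prop :=
  bases != set0 /\
  forall B1 B2, B1 \in bases -> B2 \in bases ->
    forall x, x \in B1 :\: B2 ->
      exists2 y, y \in B2 :\: B1 & (B1 :\ x) :|: [set y] \in bases.

Definition has_rank (n k : nat) (bases : {set {set 'I_n}}) : Prop :=
  forall B, B \in bases -> #|B| = k.

Definition loopless (n : nat) (bases : {set {set 'I_n}}) : Prop :=
  forall e : 'I_n, exists2 B, B \in bases & e \in B.

Definition real_representable (R : realType) (n k : nat)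
    (bases : {set {set 'I_n}}) : Prop :=
  exists X : 'M[R]_(k, n),
    \rank X = k /\
    forall f : 'I_k -> 'I_n, injective f ->
      (f @: [set: 'I_k] \in bases <-> \det (colsub f X) != 0).

Definition density (R : realType) (n k : nat) : R := n%:R / k%:R.

Definition indicator (R : realType) (n : nat) (B : {set 'I_n}) : 'I_n -> R :=
  fun e => if e \in B then 1 else 0.

Definition in_base_polytope (R : realType) (n : nat)
    (bases : {set {set 'I_n}}) (p : 'I_n -> R) : Prop :=
  exists w : {set 'I_n} -> R,
    (forall B, 0 <= w B) /\
    \sum_(B in bases) w B = 1 /\
    forall e, p e = \sum_(B in bases) w B * indicator R B e.

Definition in_base_affine_hull (R : realType) (n : nat)
    (bases : {set {set 'I_n}}) (q : 'I_n -> R) : Prop :=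
  exists w : {set 'I_n} -> R,
    \sum_(B in bases) w B = 1 /\
    forall e, q e = \sum_(B in bases) w B * indicator R B e.

Definition in_relint_base_polytope (R : realType) (n : nat)
    (bases : {set {set 'I_n}}) (p : 'I_n -> R) : Prop :=
  in_base_polytope bases p /\
  exists2 eps : R, 0 < eps &
    forall q : 'I_n -> R, in_base_affine_hull bases q ->
      (forall e, `|q e - p e| < eps) -> in_base_polytope bases q.

Definition strictly_uniformly_dense (R : realType) (n k : nat)
    (bases : {set {set 'I_n}}) : Prop :=
  in_relint_base_polytope bases (fun _ => (density R n k)^-1).

Definition projection_representation (R : realType) (n k : nat)
    (bases : {set {set 'I_n}}) (T : 'M[R]_n) : Prop :=
  T^T = T /\ T *m T = T /\
  forall f : 'I_k -> 'I_n, injective f ->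
    (f @: [set: 'I_k] \in bases <-> \det (mxsub f f T) != 0).

(* Main.v *)
(* For a factorization T = C D with D C = 1, Cauchy-Binet turns the products of
   complementary maximal minors of C and D into weights on the k-subsets whose
   total is 1 and whose marginal at e is T_ee.  For a projection representation
   these weights are positive exactly on the bases, so the diagonal of T is in
   the relative interior of the base polytope.  Conversely, let X represent M
   and let p be in the relative interior.  The convex function
     t |-> log (sum_B det(X_B)^2 exp(t(B))) - <t, p>
   attains its minimum; stationarity says that the weights
   det(X_B)^2 exp(t(B)), once normalized, have marginals p.  Scaling the columns
   of X by exp(t_e / 2) gives Y, and the orthogonal projection
   Y^T (Y Y^T)^-1 Y onto its row space has diagonal p. *)
Require Import Defs.
From HB Require Import structures.
From mathcomp Require Import all_boot all_order all_algebra.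
From mathcomp Require Import all_fingroup.
From mathcomp Require Import all_classical all_reals all_analysis.
From mathcomp Require Import ring lra.
Set Implicit Arguments.
Unset Strict Implicit.
Unset Printing Implicit Defensive.
Import Order.TTheory GRing.Theory Num.Theory.
Import numFieldNormedType.Exports.
Local Open Scope ring_scope.

(** * Cauchy-Binet weights *)

Lemma det_mulmx_ffun (R : comNzRingType) k n (A : 'M[R]_(k, n))
    (B : 'M[R]_(n, k)) :
  \det (A *m B) =
    \sum_(f : {ffun 'I_k -> 'I_n}) (\prod_i A i (f i)) * \det (rowsub f B).
Proof.
transitivity (\sum_(s : 'S_k) \sum_(f : {ffun 'I_k -> 'I_n})
    (\prod_i A i (f i)) * ((-1) ^+ s * \prod_i rowsub f B i (s i))).
  apply: eq_bigr => s _.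
  under eq_bigr do rewrite mxE.
  rewrite bigA_distr_bigA big_distrr /=; apply: eq_bigr => f _.
  rewrite big_split mulrCA; congr (_ * (_ * _)).
  by apply: eq_bigr => i _; rewrite mxE.
by rewrite exchange_big; apply: eq_bigr => f _; rewrite -big_distrr.
Qed.

(* Cauchy-Binet, summed over all maps rather than over k-subsets: each subset
   is then counted k! times. *)
Lemma cauchy_binet_ffun (R : comNzRingType) k n (A : 'M[R]_(k, n))
    (B : 'M[R]_(n, k)) :
  k`!%:R * \det (A *m B) =
    \sum_(f : {ffun 'I_k -> 'I_n}) \det (colsub f A) * \det (rowsub f B).
Proof.
(* Replacing [f] by [f] composed with [s] costs the sign of [s] and yields the [s]-th Leibniz term
   of [\det (colsub f A)]; summing over all [s] restores that determinant and produces the factor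
   k!. *)
have perm_det (s : 'S_k) : \det (A *m B) = \sum_(f : {ffun 'I_k -> 'I_n})
    ((-1) ^+ s * \prod_i colsub f A i (s i)) * \det (rowsub f B).
  rewrite det_mulmx_ffun.
  pose c (s : 'S_k) (f : {ffun 'I_k -> 'I_n}) := [ffun i => f (s i)].
  have cK : cancel (c s) (c s^-1%g).
    by move=> f; apply/ffunP => i; rewrite !ffunE permKV.
  have cKV : cancel (c s^-1%g) (c s).
    by move=> f; apply/ffunP => i; rewrite !ffunE permK.
  rewrite (reindex (c s)) /=; last by exists (c s^-1%g) => f _.
  apply: eq_bigr => f _.
  have -> : rowsub (c s f) B = perm_mx s *m rowsub f B.
    by rewrite -row_permE; apply/matrixP => i j; rewrite !mxE ffunE.
  rewrite det_mulmx det_perm mulrCA mulrA; congr (_ * _ * _).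
  by apply: eq_bigr => i _; rewrite mxE ffunE.
have -> : k`!%:R * \det (A *m B) = \sum_(s : 'S_k) \det (A *m B).
  by rewrite sumr_const card_Sn mulr_natl.
rewrite (eq_bigr _ (fun s _ => perm_det s)) exchange_big /=.
by apply: eq_bigr => f _; rewrite -big_distrl.
Qed.

(** Two block matrices multiplied in either order have the same determinant; both products are block
    triangular, with the two sides as determinants. *)
Lemma det_add1_mulmx (R : comNzRingType) m n (u : 'M[R]_(m, n))
    (v : 'M[R]_(n, m)) : \det (1%:M + u *m v) = \det (1%:M + v *m u).
Proof.
have := det_mulmx (block_mx 1%:M (- u) v 1%:M) (block_mx 1%:M 0 (- v) 1%:M).
have := det_mulmx (block_mx 1%:M 0 (- v) 1%:M) (block_mx 1%:M (- u) v 1%:M).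
rewrite !mulmx_block det_lblock !mul1mx !mulmx1 !mulmx0 !mul0mx !addr0 !add0r.
rewrite !mulNmx !mulmxN !opprK addNr subrr det_ublock det_ublock !det1 !mul1r.
by rewrite !mulr1 [v *m u + _]addrC => -> <-.
Qed.

Lemma det_colsub_ninj (R : comNzRingType) k n (A : 'M[R]_(k, n))
    (f : 'I_k -> 'I_n) : ~~ injectiveb f -> \det (colsub f A) = 0.
Proof.
move=> /injectivePn[i [j ij fij]]; rewrite -det_tr.
by apply: (determinant_alternate ij) => l; rewrite !mxE fij.
Qed.

(** Over a number field this is det(D_B) det(C_B) for a k-subset B: its k! orderings [f] all give
    the same product, since the two signs cancel. Other sets get 0, because only non-injective [f]
    can reach them. *)
Definition minor_weight (R : unitRingType) k n (C : 'M[R]_(n, k))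
    (D : 'M[R]_(k, n)) (B : {set 'I_n}) : R :=
  k`!%:R^-1 * \sum_(f : {ffun 'I_k -> 'I_n} | f @: [set: 'I_k] == B)
    \det (colsub f D) * \det (rowsub f C).

Section MinorWeight.
Variables (K : numFieldType) (k n : nat).
Implicit Types (C : 'M[K]_(n, k)) (D : 'M[K]_(k, n)) (x : 'rV[K]_n).

Lemma minor_weight_scale C D x (c : K) C' D' (B : {set 'I_n}) :
  (forall f : {ffun 'I_k -> 'I_n},
    \det (colsub f D') * \det (rowsub f C') =
    (\prod_i x 0 (f i)) * (\det (colsub f D) * \det (rowsub f C)) * c) ->
  minor_weight C' D' B = (\prod_(e in B) x 0 e) * minor_weight C D B * c.
Proof.
move=> CD'; rewrite /minor_weight mulrCA -!mulrA; congr (_ * _).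
rewrite mulrA big_distrr big_distrl /=; apply: eq_bigr => f /eqP fB.
rewrite CD'; congr (_ * _).
have [/injectiveP f_inj|f_ninj] := boolP (injectiveb f); last first.
  by rewrite det_colsub_ninj // mul0r !mulr0.
congr (_ * _); rewrite -fB big_imset /=; last by move=> i j _ _ /f_inj.
by apply: eq_bigl => i; rewrite finset.inE.
Qed.

(** Cauchy-Binet for [D] with its columns scaled by [x]: a generating polynomial of the weights,
    from which total and marginals are read off. *)
Lemma sum_minor_weight C D x :
  \sum_(B : {set 'I_n}) (\prod_(e in B) x 0 e) * minor_weight C D B =
  \det (D *m diag_mx x *m C).
Proof.
apply: (mulfI (x := k`!%:R)); first by rewrite pnatr_eq0 -lt0n fact_gt0.
rewrite cauchy_binet_ffun.
rewrite (partition_big (fun f : {ffun 'I_k -> 'I_n} => f @: [set: 'I_k]) predT) //=.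
rewrite big_distrr; apply: eq_bigr => B _ /=.
transitivity (k`!%:R * minor_weight C (D *m diag_mx x) B); last first.
  by rewrite mulVKf // pnatr_eq0 -lt0n fact_gt0.
rewrite (@minor_weight_scale C D x 1 C (D *m diag_mx x)) ?mulr1 // => f.
rewrite mulr1 mulrA; congr (_ * _).
have -> : colsub f (D *m diag_mx x) =
    colsub f D *m diag_mx (\row_i x 0 (f i)).
  by rewrite !mul_mx_diag; apply/matrixP => i j; rewrite !mxE.
rewrite det_mulmx det_diag mulrC; congr (_ * _).
by apply: eq_bigr => i _; rewrite mxE.
Qed.

Lemma sum_minor_weight1 C D : D *m C = 1%:M -> \sum_B minor_weight C D B = 1.
Proof.
move=> DC; have := sum_minor_weight C D (const_mx 1).
rewrite diag_const_mx mulmx1 DC det1 => <-.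
by apply: eq_bigr => B _; rewrite big1 ?mul1r // => e _; rewrite mxE.
Qed.

(** Taking [x] equal to 2 at [e] and 1 elsewhere counts the sets containing [e] twice. It also makes
    the determinant that of a rank-one update of the identity, namely 1 + (CD)_ee. *)
Lemma minor_weight_marginal C D e : D *m C = 1%:M ->
  \sum_(B : {set 'I_n}) minor_weight C D B * (e \in B)%:R = (C *m D) e e.
Proof.
move=> DC; pose x : 'rV[K]_n := \row_i (1 + (i == e)%:R).
have xB (B : {set 'I_n}) : \prod_(i in B) x 0 i = 1 + (e \in B)%:R.
  have [eB|eB] := boolP (e \in B).
    rewrite (bigD1 e) //= mxE eqxx big1 ?mulr1 // => i /andP[_ /negPf ie].
    by rewrite mxE ie addr0.
  rewrite big1 ?addr0 // => i iB; rewrite mxE.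
  by case: eqP => [ie|]; [rewrite -ie iB in eB | rewrite addr0].
have := sum_minor_weight C D x.
under eq_bigr => B _ do rewrite xB mulrDl mul1r mulrC.
rewrite big_split /= sum_minor_weight1 //.
have -> : diag_mx x = 1%:M + delta_mx e 0 *m (delta_mx 0 e : 'rV_n).
  rewrite mul_delta_mx; apply/matrixP => i j; rewrite !mxE.
  case: (eqVneq i j) => [<-|ij]; first by rewrite andbb.
  rewrite mulr0n add0r; case: (eqVneq i e) => //= ie.
  by rewrite -ie eq_sym (negPf ij).
rewrite mulmxDr mulmxDl mulmx1 DC mulmxA -mulmxA det_add1_mulmx det_mx11.
rewrite mulmxA -rowE -colE !mxE eqxx => /addrI ->.
by apply: eq_bigr => i _; rewrite !mxE.
Qed.

Lemma minor_weight_support (bases : {set {set 'I_n}}) C D :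
  has_rank k bases ->
  (forall f : {ffun 'I_k -> 'I_n},
    0 <= \det (colsub f D) * \det (rowsub f C)) ->
  (forall f : {ffun 'I_k -> 'I_n}, injective f ->
    (f @: [set: 'I_k] \in bases <-> \det (colsub f D) * \det (rowsub f C) != 0)) ->
  forall B, (B \in bases -> 0 < minor_weight C D B) /\
            (B \notin bases -> minor_weight C D B = 0).
Proof.
move=> hk ge0 supp B; have kV_gt0 : 0 < k`!%:R^-1 :> K.
  by rewrite invr_gt0 ltr0n fact_gt0.
split=> hB; last first.
  rewrite /minor_weight big1 ?mulr0 // => f /eqP fB.
  have [/injectiveP f_inj|f_ninj] := boolP (injectiveb f); last first.
    by rewrite det_colsub_ninj // mul0r.
  by apply/eqP/negPn/negP => /(supp f f_inj); rewrite fB (negPf hB).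
rewrite /minor_weight mulr_gt0 //.
pose f : {ffun 'I_k -> 'I_n} :=
  [ffun i => enum_val (cast_ord (esym (hk B hB)) i)].
have f_inj : injective f.
  by move=> i j; rewrite !ffunE => /enum_val_inj/cast_ord_inj.
have fB : f @: [set: 'I_k] = B.
  apply/eqP; rewrite eqEcard card_imset // cardsT card_ord hk // leqnn andbT.
  by apply/fintype.subsetP => _ /imsetP[i _ ->]; rewrite ffunE enum_valP.
rewrite (bigD1 f) ?fB //= ltr_pwDl ?sumr_ge0 //.
by rewrite lt0r ge0 andbT; apply/supp => //; rewrite fB.
Qed.

End MinorWeight.

(** * The relative interior of the base polytope *)

(* Here [a] is the matrix of a linear map, and its pseudo-inverse is a section
   on the image that is bounded for the sup norms. *)
Lemma bounded_preimage (R : realFieldType) (I J : finType) (a : I -> J -> R) :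
  exists2 c : R, 0 < c & forall u : I -> R, exists2 u' : I -> R,
    forall j, \sum_i u' i * a i j = \sum_i u i * a i j &
    forall eps, 0 <= eps -> (forall j, `|\sum_i u i * a i j| <= eps) ->
      forall i, `|u' i| <= c * eps.
Proof.
pose M : 'M[R]_(#|I|, #|J|) := \matrix_(i, j) a (enum_val i) (enum_val j).
pose P := pinvmx M.
have P_ge0 : 0 <= \sum_i \sum_j `|P i j|.
  by do 2 (apply: sumr_ge0 => ? _).
exists (1 + \sum_i \sum_j `|P i j|) => [|u]; first by rewrite ltr_pwDl.
pose z := (\row_i u (enum_val i)) *m M.
have zE (v : 'rV_#|I|) j :
    (v *m M) 0 (enum_rank j) = \sum_i v 0 (enum_rank i) * a i j.
  rewrite mxE (reindex _ (onW_bij _ (enum_rank_bij I))).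
  by apply: eq_bigr => i _; rewrite mxE !enum_rankK.
exists (fun i => (z *m P) 0 (enum_rank i)) => [j|eps eps_ge0 u_eps i].
  rewrite -zE mulmxKpV ?submxMl // zE.
  by apply: eq_bigr => i _; rewrite mxE enum_rankK.
have z_eps j : `|z 0 j| <= eps.
  rewrite -[j]enum_valK zE; under eq_bigr do rewrite mxE enum_rankK.
  exact: u_eps.
rewrite mxE (le_trans (ler_norm_sum _ _ _)) //.
apply: (@le_trans _ _ (\sum_j `|P j (enum_rank i)| * eps)).
  apply: ler_sum => j _; rewrite normrM mulrC ler_wpM2l //; exact: z_eps.
rewrite -mulr_suml ler_wpM2r //.
rewrite (le_trans (y := \sum_i \sum_j `|P i j|)) ?lerDr ?ler01 //.
apply: ler_sum => j _; rewrite (bigD1 (enum_rank i)) //= lerDl.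
exact: sumr_ge0.
Qed.

Section RelativeInterior.
Variables (R : realType) (n : nat) (bases : {set {set 'I_n}}).
Implicit Types (p t : 'I_n -> R) (w a : {set 'I_n} -> R).

(** A small move of [p] within the affine hull is realized by a small change of the weights, thanks
    to [bounded_preimage]; strictly positive weights stay nonnegative under it. *)
Lemma positive_weights_relint p w :
  (forall B, B \in bases -> 0 < w B) -> \sum_(B in bases) w B = 1 ->
  (forall e, p e = \sum_(B in bases) w B * indicator R B e) ->
  in_relint_base_polytope bases p.
Proof.
move=> w_gt0 w1 wp; split.
  exists (fun B => if B \in bases then w B else 0); split.
    by move=> B; case: ifP => // /w_gt0/ltW.
  split; first by rewrite -w1; apply: eq_bigr => B ->.
  by move=> e; rewrite wp; apply: eq_bigr => B ->.
(* The coordinate [None] records the total weight, so that the correction [u] preserves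
   normalization as well as matching the marginals. *)
pose a (B : {set 'I_n}) (j : option 'I_n) : R :=
  if B \in bases then (if j is Some e then indicator R B e else 1) else 0.
have [c c_gt0 bdd] := bounded_preimage a.
have aE (u : {set 'I_n} -> R) j : \sum_B u B * a B j =
    \sum_(B in bases) u B * (if j is Some e then indicator R B e else 1).
  rewrite [RHS]big_mkcond; apply: eq_bigr => B _; rewrite /a.
  by case: ifP; rewrite ?mulr0.
have w_ge0 B : B \in bases -> 0 <= (w B)^-1.
  by move=> /w_gt0 wB; rewrite invr_ge0 ltW.
(* [s] dominates every inverse weight, so [s^-1] is a positive lower bound for all [w B]. *)
pose s := 1 + \sum_(B in bases) (w B)^-1.
have s_gt0 : 0 < s by rewrite ltr_pwDl ?sumr_ge0.
exists (c * s)^-1; first by rewrite invr_gt0 mulr_gt0.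
move=> q [v [v1 vq]] pq.
have [u uE u_le] := bdd (fun B => v B - w B).
have diffE j : \sum_B (v B - w B) * a B j =
    if j is Some e then q e - p e else 0.
  rewrite aE; under eq_bigr do rewrite mulrBl.
  rewrite big_split sumrN /=; case: j => [e|] /=; first by rewrite -vq -wp.
  by rewrite -!mulr_suml !mulr1 v1 w1 subrr.
have uw B : B \in bases -> 0 <= w B + u B.
  move=> hB; have : `|u B| <= c * (c * s)^-1.
    have cs_ge0 : 0 <= (c * s)^-1 by rewrite invr_ge0 ltW // mulr_gt0.
    by apply: u_le => // -[e|]; rewrite diffE ?normr0 //; exact/ltW/pq.
  rewrite invfM mulVKf ?gt_eqF // => uB.
  suff: s^-1 <= w B by move: uB; rewrite ler_norml; lra.
  rewrite -[w B]invrK lef_pV2 ?posrE ?invr_gt0 ?w_gt0 //.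
  rewrite /s (bigD1 B) //= addrCA lerDl addr_ge0 ?sumr_ge0 // => B' /andP[].
  by move=> /w_ge0.
exists (fun B => if B \in bases then w B + u B else 0).
split; first by move=> B; case: ifP => // /uw.
have u_sum j := etrans (esym (aE u j)) (etrans (uE j) (diffE j)).
split; [have := u_sum None | move=> e; have := u_sum (Some e)] => /= uj.
  rewrite (eq_bigr (fun B => w B + u B * 1)); last first.
    by move=> B ->; rewrite mulr1.
  by rewrite big_split /= uj w1 addr0.
rewrite (eq_bigr (fun B => w B * indicator R B e + u B * indicator R B e)).
  by rewrite big_split /= uj -wp addrC subrK.
by move=> B ->; rewrite mulrDl.
Qed.

End RelativeInterior.

(** * Exponential tilting by convex minimization *)

Lemma expR_sum_stationary (R : realType) (I : finType) (P : pred I)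
    (c x : I -> R) :
  (forall s, \sum_(i | P i) c i <= \sum_(i | P i) c i * expR (s * x i)) ->
  \sum_(i | P i) c i * x i = 0.
Proof.
move=> c_min.
pose f : R -> R := \sum_(j < #|I|)
  (fun s : R => (if P (enum_val j) then c (enum_val j) else 0) *
     expR (s * x (enum_val j))).
have sumE (F : I -> R) :
    \sum_(j < #|I|) (if P (enum_val j) then F (enum_val j) else 0) =
    \sum_(i | P i) F i.
  rewrite [RHS]big_mkcond (reindex _ (onW_bij _ (enum_rank_bij I))).
  by apply: eq_bigr => i _; rewrite enum_rankK.
have fE s : f s = \sum_(i | P i) c i * expR (s * x i).
  rewrite /f fct_sumE -sumE; apply: eq_bigr => j _.
  by case: ifP; rewrite ?mul0r.
have f_derive (s : R) : is_derive s 1 f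
    (\sum_(j < #|I|) (if P (enum_val j) then c (enum_val j) else 0) *
       (expR (s * x (enum_val j)) * x (enum_val j))).
  apply: is_derive_sum => j.
  have lin : is_derive s 1 ( *%R^~ (x (enum_val j))) (x (enum_val j)).
    have := is_deriveM (is_derive_id s 1) (is_derive_cst (x (enum_val j)) s 1).
    by rewrite scaler0 add0r [_ *: _]mulr1.
  exact: is_deriveZ (is_derive1_comp (is_derive_expR _) lin).
have f0 : is_derive (0 : R) 1 f 0.
  (* The inequality holds for all [s], so any open interval around 0 will do. *)
  apply: (@derive1_at_min R f (-1) 1); rewrite ?in_itv /= ?ltrN10 ?ltr01 //.
  move=> t _; rewrite !fE; under eq_bigr do rewrite mul0r expR0 mulr1.
  exact: c_min.
have := @derive_val _ _ _ _ _ _ _ f0.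
rewrite (@derive_val _ _ _ _ _ _ _ (f_derive 0)) => stat.
rewrite -[RHS]stat -sumE; apply: eq_bigr => j _.
by case: ifP; rewrite !mul0r ?expR0 ?mul1r.
Qed.

Section Tilt.
Variables (R : realType) (n : nat) (bases : {set {set 'I_n}}).
Implicit Types (p t : 'I_n -> R) (a : {set 'I_n} -> R).

Let pairing p t (B : {set 'I_n}) := \sum_e t e * (indicator R B e - p e).

(** The segment from the vertex of [B] through [p] continues inside the polytope to a point [q]. The
    pairing at [q] is a fixed negative multiple of that at [B] and, as an average over bases, is at
    most [c]. Upper bounds thus give lower bounds, uniformly in [t]. *)
Lemma relint_pairing_bound p : in_relint_base_polytope bases p ->
  exists2 d : R, 0 < d & forall t c, 0 <= c ->
    (forall B, B \in bases -> pairing p t B <= c) ->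
    forall B, B \in bases -> `|pairing p t B| <= d * c.
Proof.
case=> -[w [w_ge0 [w1 wp]]] [eps eps_gt0 rel].
have N_ge0 : 0 <= \sum_e `|p e| by apply: sumr_ge0.
(* Each coordinate of 1_B - p is at most 1 + sum |p_e| in absolute value, so this step keeps [q]
   strictly within [eps] of [p]. *)
pose d := eps / (2 + \sum_e `|p e|).
have d_gt0 : 0 < d by rewrite divr_gt0 // ltr_wpDr.
exists (1 + d^-1) => [|t c c_ge0 t_le B hB].
  by rewrite ltr_wpDr ?invr_ge0 ?ltW.
pose q e := p e - d * (indicator R B e - p e).
have [|e|w' [w'_ge0 [w'1 w'q]]] := rel q.
- exists (fun B' => (1 + d) * w B' - d * (B' == B)%:R).
  have sumB (F : {set 'I_n} -> R) :
      \sum_(B' in bases) d * (B' == B)%:R * F B' = d * F B.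
    rewrite (bigD1 B) //= eqxx mulr1 big1 ?addr0 // => B' /andP[_ /negPf ->].
    by rewrite mulr0 mul0r.
  split.
    have := sumB (fun=> 1); under eq_bigr do rewrite mulr1.
    by move=> sB; rewrite big_split sumrN /= sB -mulr_sumr w1; ring.
  move=> e; under eq_bigr do rewrite mulrBl -mulrA.
  by rewrite big_split sumrN -mulr_sumr -wp sumB /q /=; ring.
- have pe : `|p e| <= \sum_e `|p e| by rewrite (bigD1 e) //= lerDl sumr_ge0.
  rewrite /q addrAC subrr add0r normrN normrM gtr0_norm // /d -mulrA.
  rewrite gtr_pMr // mulrC ltr_pdivrMr ?ltr_wpDr // mul1r.
  rewrite (le_lt_trans (ler_normB _ _)) //.
  suff: `|indicator R B e| <= 1 by lra.
  by rewrite /indicator; case: ifP; rewrite ?normr1 ?normr0.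
have pairq : \sum_(B' in bases) w' B' * pairing p t B' = - d * pairing p t B.
  under eq_bigr do rewrite mulr_sumr.
  rewrite exchange_big mulr_sumr; apply: eq_bigr => e _ /=.
  transitivity (t e * (q e - p e)); last by rewrite /q; ring.
  rewrite w'q -[X in _ - X]mul1r -w'1 mulr_suml -sumrB mulr_sumr.
  by apply: eq_bigr => B' _; ring.
have : - d * pairing p t B <= c.
  rewrite -pairq -[c]mul1r -w'1 mulr_suml ler_sum // => B' hB'.
  by rewrite ler_wpM2l // t_le.
have := t_le _ hB => le1 le2; rewrite ler_norml mulrDl mul1r.
have : - (d^-1 * c) <= pairing p t B.
  by rewrite lerNl mulrC ler_pdivlMr //; lra.
have : 0 <= d^-1 * c by rewrite mulr_ge0 // invr_ge0 ltW.
by move=> *; apply/andP; split; lra.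
Qed.

(* [t] minimizes the convex function sum_B a_B exp <t, 1_B - p>.  The sublevel
   sets are bounded modulo the directions along which it is constant, because p
   is in the relative interior; so the minimum is attained. *)
Lemma relint_tilt p a :
  (forall B, B \in bases -> 0 < a B) -> in_relint_base_polytope bases p ->
  exists t, forall e,
    \sum_(B in bases) a B * (\prod_(i in B) expR (t i)) * indicator R B e =
    p e * \sum_(B in bases) a B * \prod_(i in B) expR (t i).
Proof.
move=> a_gt0 relp.
pose Phi t := \sum_(B in bases) a B * expR (pairing p t B).
pose Phi0 := \sum_(B in bases) a B.
have Phi0_ge0 : 0 <= Phi0 by apply: sumr_ge0 => B /a_gt0/ltW.
have [d d_gt0 bound] := relint_pairing_bound relp.
(* When [Phi t <= Phi0], each single term is at most [Phi0], and x <= exp x bounds the pairing by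
   [Phi0 / a B]; [c0] dominates all these bounds. *)
pose c0 := \sum_(B in bases) Phi0 / a B.
have c0_ge0 : 0 <= c0.
  by apply: sumr_ge0 => B /a_gt0/ltW aB; rewrite divr_ge0.
pose D e (B : {set 'I_n}) : R :=
  if B \in bases then indicator R B e - p e else 0.
have DE t B : \sum_e t e * D e B = if B \in bases then pairing p t B else 0.
  by rewrite /D; case: ifP => // _; rewrite big1 // => e _; rewrite mulr0.
have [K K_gt0 section] := bounded_preimage D.
pose r := K * (d * c0).
(* [Phi] sees [t] only through its pairings, so [t] may be replaced by a bounded preimage of the
   same pairings. *)
have reduce t : Phi t <= Phi0 ->
    exists2 t', forall e, `|t' e| <= r & Phi t' = Phi t.
  move=> t_le; have [t' t'E t'_le] := section t; exists t'.
    apply: t'_le => [|B]; first by rewrite mulr_ge0 // ltW.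
    rewrite DE; case: ifP => hB; last by rewrite normr0 mulr_ge0 // ltW.
    apply: bound => // {}B {}hB.
    have aE : a B * expR (pairing p t B) <= Phi0.
      rewrite (le_trans _ t_le) // /Phi (bigD1 B) //= lerDl sumr_ge0 //.
      by move=> B' /andP[/a_gt0/ltW aB' _]; rewrite mulr_ge0 ?expR_ge0.
    have : pairing p t B <= Phi0 / a B.
      rewrite ler_pdivlMr ?a_gt0 // mulrC (le_trans _ aE) //.
      apply: ler_wpM2l; first exact/ltW/a_gt0.
      by rewrite (le_trans _ (expR_ge1Dx _)) // lerDr.
    move=> /le_trans; apply; rewrite /c0 (bigD1 B) //= lerDl sumr_ge0 //.
    by move=> B' /andP[/a_gt0/ltW aB' _]; rewrite divr_ge0.
  apply: eq_bigr => B hB; congr (_ * expR _).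
  by have := t'E B; rewrite !DE hB.
have r_ge0 : 0 <= r by rewrite !mulr_ge0 // ltW.
pose F (v : 'rV[R]_n) := Phi (fun e => v 0 e).
have F_cont : continuous F.
  move=> v; apply: (cvg_big add_continuous (nbhs_filter v)) => B _.
  apply: cvgM; first exact: cst_continuous.
  apply: continuous_comp; last exact: continuous_expR.
  apply: (cvg_big add_continuous (nbhs_filter v)) => e _.
  apply: cvgM; last exact: cst_continuous.
  exact: coord_continuous.
pose box := [set v : 'rV[R]_n | forall i, `[- r, r]%classic (v ord0 i)]%classic.
have box_cpt : compact box.
  apply: (@rV_compact _ _ (fun=> `[- r, r]%classic)) => i.
  exact: segment_compact.
have boxE v : (v \in box) = [forall e, `|v 0 e| <= r].
  apply/idP/forallP => [|v_le].
    by rewrite inE => v_le e; have := v_le e; rewrite /= in_itv /= ler_norml.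
  by rewrite inE => e; have := v_le e; rewrite /= in_itv /= ler_norml.
have box0 : (box !=set0)%classic.
  by exists 0 => e; rewrite mxE /= in_itv /= oppr_le0 r_ge0.
have [v v_box v_min] := EVT_min_rV box0 box_cpt (continuous_subspaceT F_cont).
pose t e := v 0 e.
have Phi0E : Phi (fun=> 0) = Phi0.
  apply: eq_bigr => B _; rewrite [pairing _ _ _]big1 ?expR0 ?mulr1 // => e _.
  by rewrite mul0r.
have t_le u (u_le : forall e, `|u e| <= r) : Phi t <= Phi u.
  have := v_min (\row_e u e); rewrite boxE /F.
  have -> : (fun e => (\row_e u e) 0 e) = u by apply/funext => e; rewrite mxE.
  by apply; apply/forallP => e; rewrite mxE.
(* The minimum over the box is global: below [Phi0] a point reduces into the box, and above [Phi0]
   it loses to the origin. *)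
have t_min u : Phi t <= Phi u.
  have [/reduce[u' u'_le <-]|/ltW] := leP (Phi u) Phi0; first exact: t_le.
  by apply: le_trans; rewrite -Phi0E t_le // => e; rewrite normr0.
exists t => e; apply/eqP; rewrite -subr_eq0 mulr_sumr -sumrB; apply/eqP.
have stat : \sum_(B in bases)
    a B * expR (pairing p t B) * (indicator R B e - p e) = 0.
  apply: expR_sum_stationary => s.
  rewrite (le_trans (t_min (fun i => t i + s * (i == e)%:R))) //.
  rewrite le_eqVlt; apply/orP; left; apply/eqP; apply: eq_bigr => B _.
  rewrite -mulrA -expRD; congr (_ * expR _).
  rewrite /pairing; under eq_bigr do rewrite mulrDl.
  rewrite big_split /=; congr (_ + _).
  rewrite (bigD1 e) //= eqxx mulr1 big1 ?addr0 // => i /negPf ->.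
  by rewrite mulr0 mul0r.
(* This positive factor exp(-<t, p>) turns the products over [B] into the exponentials of pairings
   that occur in [stat]. *)
apply: (mulfI (x := expR (- \sum_i t i * p i))).
  by rewrite gt_eqF ?expR_gt0.
rewrite mulr0 -[RHS]stat mulr_sumr; apply: eq_bigr => B _.
have -> : pairing p t B = - (\sum_i t i * p i) + \sum_(i in B) t i.
  rewrite addrC /pairing; under eq_bigr do rewrite mulrBr.
  rewrite big_split sumrN [in RHS]big_mkcond; congr (_ - _).
  apply: eq_bigr => i _.
  by rewrite /indicator; case: ifP; rewrite ?mulr1 ?mulr0.
by rewrite expRD expR_sum; ring.
Qed.

End Tilt.

(** * Projection representations *)

(** In a full-rank factorization T = CD, idempotence reads C(DC)D = CD, and cancelling both outer
    factors leaves DC = 1. Then the rank is the trace of DC, hence of [T]. *)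
Lemma idempotent_mx_factor (F : numFieldType) n k (T : 'M[F]_n) :
  T *m T = T -> \tr T = k%:R ->
  exists (C : 'M[F]_(n, k)) (D : 'M[F]_(k, n)), T = C *m D /\ D *m C = 1%:M.
Proof.
move=> TT trT; have defT := mulmx_base T.
have DC : row_base T *m col_base T = 1%:M.
  apply: (row_full_inj (col_base_full T)).
  apply: (row_free_inj (row_base_free T)).
  by rewrite mulmx1 mulmxA -mulmxA !defT TT.
have : \rank T = k.
  apply/eqP; rewrite -(eqr_nat F) -trT -[in \tr T]defT mxtrace_mulC DC.
  by rewrite mxtrace1.
(* The factors are generalized so that the dimension [\rank T] in their types can be rewritten to
   [k]. *)
move: (col_base T) (row_base T) DC defT => C D + + rT.
by move: C D; rewrite rT => C D DC defT; exists C, D.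
Qed.

(** By Cauchy-Binet, k! times this determinant is a sum of squares. *)
Lemma det_tr_mulmx_ge0 (R : realFieldType) m k (A : 'M[R]_(m, k)) :
  0 <= \det (A^T *m A).
Proof.
have fact_gt0 : 0 < k`!%:R :> R by rewrite ltr0n fact_gt0.
rewrite -(pmulr_rge0 _ fact_gt0) cauchy_binet_ffun sumr_ge0 // => f _.
by rewrite -det_tr -trmx_mxsub trmxK -expr2 sqr_ge0.
Qed.

Lemma minor_weight_relint (R : realType) n k (bases : {set {set 'I_n}})
    (C : 'M[R]_(n, k)) (D : 'M[R]_(k, n)) :
  (forall B, B \in bases -> 0 < minor_weight C D B) ->
  (forall B, B \notin bases -> minor_weight C D B = 0) ->
  D *m C = 1%:M ->
  in_relint_base_polytope bases (fun e => (C *m D) e e).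
Proof.
move=> gt0 eq0 DC.
have sum_bases (F : {set 'I_n} -> R) :
    \sum_B minor_weight C D B * F B =
    \sum_(B in bases) minor_weight C D B * F B.
  rewrite [RHS]big_mkcond; apply: eq_bigr => B _; case: ifPn => // /eq0 ->.
  by rewrite mul0r.
apply: (positive_weights_relint gt0) => [|e].
  rewrite -(sum_minor_weight1 DC); have := sum_bases (fun=> 1).
  by rewrite -!mulr_suml !mulr1.
rewrite -minor_weight_marginal // sum_bases; apply: eq_bigr => B _.
by rewrite /indicator; case: (e \in B).
Qed.

(** A principal minor of T = CD is the product of the minors of [C] and [D]. It is nonnegative
    because T = T^T T makes it a Gram determinant, so the weights are positive exactly on the
    bases. *)
Lemma projection_representation_relint (R : realType) n k
    (bases : {set {set 'I_n}}) (T : 'M[R]_n) :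
  has_rank k bases -> projection_representation k bases T -> \tr T = k%:R ->
  in_relint_base_polytope bases (fun e => T e e).
Proof.
move=> hk [Tsym [TT Trep]] trT.
have [C [D [defT DC]]] := idempotent_mx_factor TT trT.
have minorE (f : 'I_k -> 'I_n) :
    \det (colsub f D) * \det (rowsub f C) = \det (mxsub f f T).
  by rewrite defT mxsub_mul det_mulmx mulrC.
have minor_ge0 (f : {ffun 'I_k -> 'I_n}) :
    0 <= \det (colsub f D) * \det (rowsub f C).
  rewrite minorE -TT mxsub_mul -{1}Tsym -trmx_mxsub; exact: det_tr_mulmx_ge0.
have [|gt0 eq0] := all_and2 (minor_weight_support hk minor_ge0 _).
  by move=> f; rewrite minorE; apply: Trep.
by rewrite defT; apply: minor_weight_relint.
Qed.

Lemma relint_projection_representation (R : realType) n k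
    (bases : {set {set 'I_n}}) (p : 'I_n -> R) :
  has_rank k bases -> real_representable R k bases ->
  in_relint_base_polytope bases p ->
  exists2 T : 'M[R]_n, projection_representation k bases T &
    forall e, T e e = p e.
Proof.
move=> hk [X [_ Xrep]] relp.
have sqr_minor (f : 'I_k -> 'I_n) :
    \det (colsub f X) * \det (rowsub f X^T) = \det (colsub f X) ^+ 2.
  by rewrite -trmx_mxsub det_tr.
pose a := minor_weight X^T X.
have a_supp : forall B, (B \in bases -> 0 < a B) /\ (B \notin bases -> a B = 0).
  apply: minor_weight_support => // f; rewrite sqr_minor ?sqr_ge0 // => f_inj.
  by rewrite expf_eq0 /=; apply: Xrep.
have [t tE] := relint_tilt (fun B => (a_supp B).1) relp.
(* The exponent is halved because the minors of [Y] enter the weights squared. *)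
pose h : 'rV[R]_n := \row_e expR (t e / 2).
pose Y := X *m diag_mx h; pose Z := \det (Y *m Y^T).
have h2 e : h 0 e * h 0 e = expR (t e) by rewrite mxE -expRD -splitr.
have colY (f : 'I_k -> 'I_n) :
    \det (colsub f Y) = \det (colsub f X) * \prod_i h 0 (f i).
  have -> : colsub f Y = colsub f X *m diag_mx (\row_i h 0 (f i)).
    by rewrite /Y !mul_mx_diag; apply/matrixP => i j; rewrite !mxE.
  rewrite det_mulmx det_diag; congr (_ * _).
  by apply: eq_bigr => i _; rewrite mxE.
have ZE : Z = \sum_(B in bases) a B * \prod_(i in B) expR (t i).
  have -> : Z = \det (X *m diag_mx (\row_e expR (t e)) *m X^T).
    rewrite /Z /Y trmx_mul tr_diag_mx !mulmxA -[X *m _ *m _]mulmxA mulmx_diag.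
    by congr (\det (_ *m diag_mx _ *m _)); apply/rowP => e; rewrite mxE h2 mxE.
  rewrite -sum_minor_weight [RHS]big_mkcond; apply: eq_bigr => B _.
  rewrite -/a; case: ifPn => [_|/(a_supp B).2 ->]; last by rewrite mulr0.
  by rewrite mulrC; congr (_ * _); apply: eq_bigr => i _; rewrite mxE.
have Z_gt0 : 0 < Z.
  (* Weights of total 1 over [bases] force a basis to exist. *)
  have [w [_ [w1 _]]] := relp.1.
  have [B hB|noB] := pickP (mem bases); last first.
    by move: w1 => /eqP; rewrite big_pred0 // eq_sym oner_eq0.
  have term_ge0 B' : B' \in bases -> 0 < a B' * \prod_(i in B') expR (t i).
    move=> /(a_supp B').1 aB'; rewrite mulr_gt0 // prodr_gt0 // => i _.
    exact: expR_gt0.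
  rewrite ZE (bigD1 B) //= ltr_pwDl ?term_ge0 // sumr_ge0 // => B' /andP[hB' _].
  exact/ltW/term_ge0.
have YY_unit : Y *m Y^T \in unitmx by rewrite unitmxE unitfE gt_eqF.
(* The Moore-Penrose right inverse of [Y]; its minors are those of [Y] divided by [Z]. *)
pose C := Y^T *m invmx (Y *m Y^T).
have DC : Y *m C = 1%:M by rewrite mulmxA mulmxV.
have minorE (f : 'I_k -> 'I_n) :
    \det (colsub f Y) * \det (rowsub f C) = \det (colsub f Y) ^+ 2 * Z^-1.
  rewrite /C -mul_rowsub_mx det_mulmx det_inv -trmx_mxsub det_tr mulrA.
  by rewrite -expr2.
have weightE B : minor_weight C Y B = (\prod_(i in B) expR (t i)) * a B * Z^-1.
  rewrite (minor_weight_scale (x := \row_e expR (t e)) (C := X^T) (D := X)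
    (c := Z^-1)) => [|f].
    by rewrite -/a; congr (_ * _ * _); apply: eq_bigr => i _; rewrite mxE.
  rewrite minorE colY sqr_minor exprMn mulrC [in RHS]mulrC; congr (_ * _).
  rewrite mulrC; congr (_ * _); rewrite -prodrXl; apply: eq_bigr => i _.
  by rewrite expr2 h2 mxE.
exists (C *m Y); last first.
  move=> e; rewrite -minor_weight_marginal //.
  rewrite -[RHS](mulfK (lt0r_neq0 Z_gt0)) {1}ZE -tE mulr_suml.
  rewrite [RHS]big_mkcond; apply: eq_bigr => B _; rewrite weightE.
  case: ifPn => [_|/(a_supp B).2 ->]; last by rewrite mulr0 !mul0r.
  by rewrite /indicator; case: (e \in B) => /=; ring.
split.
  clearbody Y.
  by rewrite trmx_mul /C trmx_mul trmx_inv trmx_mul !trmxK mulmxA.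
split; first by rewrite -mulmxA [Y *m _]mulmxA DC mul1mx.
move=> f f_inj; rewrite Xrep // mxsub_mul det_mulmx mulrC minorE.
rewrite mulf_eq0 invr_eq0 (gt_eqF Z_gt0) orbF expf_eq0 /= colY mulf_eq0.
have -> : (\prod_i h 0 (f i) == 0) = false.
  by apply/gt_eqF/prodr_gt0 => i _; rewrite mxE expR_gt0.
by rewrite orbF.
Qed.

Theorem theorem4p10 (R : realType) (n k : nat) (bases : {set {set 'I_n}})
    (hM : is_matroid bases) (hk : has_rank k bases) (hl : loopless bases)
    (hrep : real_representable R k bases) :
  strictly_uniformly_dense R k bases <->
  exists T : 'M[R]_n,
    projection_representation k bases T /\
    forall i : 'I_n, T i i = (density R n k)^-1.
Proof.
split=> [/(relint_projection_representation hk hrep)[T Trep Tdiag]|].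
  by exists T.
move=> [T [Trep Tdiag]].
have trT : \tr T = k%:R.
  rewrite /mxtrace (eq_bigr _ (fun i _ => Tdiag i)) sumr_const card_ord.
  rewrite /density invf_div -[_ *+ n]mulr_natr.
  (* For n = 0 the quotient k / n is 0 by convention; the trace is still [k], since a basis inside
     the empty ground set forces k = 0. *)
  have [n0|n_gt0] := posnP n; last by rewrite mulfVK // pnatr_eq0 -lt0n.
  have /set0Pn[B hB] := hM.1.
  have := max_card (mem B).
  by rewrite card_ord (hk B hB) n0 leqn0 mulr0 => /eqP ->.
rewrite /strictly_uniformly_dense.
have <- : (fun e => T e e) = (fun=> (density R n k)^-1) by apply/funext => e.
exact: projection_representation_relint hk Trep trT.
Qed.
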